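(* Suppose that $B \subseteq \mathbb{R}^n$ is a nonempty convex compact set and that $F:\mathbb{R}^n\times\mathbb{R}^n\to\mathbb{R}^n$ is continuously differentiable on $\mathbb{R}^n \times \mathbb{R}^n$. Then, for any $\alpha > 0$, the gap function $\varphi_\alpha$ is Lipschitz continuous on $B$ with constant $$L_1 + L_2\,L_3(\alpha),$$ where $$L_1 = \max_{x \in B,\, y \in \mathcal{C}} \|F(x,y)\|, \qquad L_2 = \max_{x \in B,\, y \in \mathcal{C}} \|x - y\|, \qquad L_3(\alpha) = \max_{x \in B,\, y \in \mathcal{C}} \| \alpha\,I - \nabla_1 F(x,y) \|,$$ and $\nabla_1 F(x,y)$ denotes the Jacobian matrix of $F(\cdot,y)$ at $x$.
   Context: $\mathcal{C}\subseteq\mathbb{R}^n$ is a nonempty compact convex set, $F:\mathbb{R}^n\times\mathbb{R}^n\to\mathbb{R}^n$ is a map, and $f:\mathbb{R}^n\times\mathbb{R}^n\to\mathbb{R}$ is the bifunction $f(x,y)=\langle F(x,y),\,y-x\rangle$. Standing assumptions: $f$ is continuous, and for any $x\in\mathcal{C}$ the function $f(x,\cdot)$ is convex and $f(x,x)=0$. For $\alpha\ge 0$, the gap function is $$\varphi_\alpha(x) := \max_{y \in \mathcal{C}} \left[ -f(x,y) - \frac{\alpha}{2}\,\|y-x\|^2 \right],\qquad x\in\mathbb{R}^n.$$ For vectors, $\|\cdot\|$ and $\langle\cdot,\cdot\rangle$ denote the Euclidean norm and inner product; for matrices, $\|\cdot\|$ is the induced (spectral) norm; $I$ is the $n\times n$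 identity matrix. ''Lipschitz continuous on $B$ with constant $K$'' means $|\varphi_\alpha(x)-\varphi_\alpha(x')|\le K\|x-x'\|$ for all $x,x'\in B$. *)

(* Defs.v *)
From mathcomp Require Import all_boot all_order all_algebra.
From mathcomp Require Import all_classical all_reals all_analysis.
Import Order.TTheory GRing.Theory Num.Theory.
Import numFieldNormedType.Exports.

Set Implicit Arguments.
Unset Strict Implicit.
Unset Printing Implicit Defensive.

Local Open Scope classical_set_scope.
Local Open Scope ring_scope.

(* R^n is 'rV[R]_n. The library norm `| u | on 'rV[R]_n is the sup norm, so
   the Euclidean norm is introduced separately; the topology, and hence
   continuity, compactness and differentiability, is the same for both. *)
Definition dotp (R : realType) (n : nat) (u v : 'rV[R]_n) : R :=
  \sum_(i < n) u 0 i * v 0 i.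

Definition enorm (R : realType) (n : nat) (u : 'rV[R]_n) : R :=
  Num.sqrt (dotp u u).

(* Operator norm induced by enorm. As everywhere in the library for row
   vectors, a matrix A stands for the linear map v |-> v *m A. *)
Definition opnorm (R : realType) (m n : nat) (A : 'M[R]_(m, n)) : R :=
  sup [set enorm (v *m A) | v in [set v : 'rV[R]_m | enorm v <= 1]].

(* The greatest element of A; it is the junk value 0 when A has none. *)
Definition setmax (R : realType) (A : set R) : R := xget 0 (A `&` ubound A).

Section gap.
Variables (R : realType) (n : nat).
Implicit Types (F : 'rV[R]_n * 'rV[R]_n -> 'rV[R]_n) (B C : set 'rV[R]_n).

(* The derivative is taken jointly in the two variables; its continuity is
   that of its matrix, where R^n * R^n is identified with R^(n + n). *)
Definition continuously_differentiable F : Prop :=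
  (forall p, differentiable F p) /\
  continuous (fun p =>
    lin1_mx (fun u : 'rV[R]_(n + n) => 'd F p (lsubmx u, rsubmx u))
      : 'M[R]_(n + n, n)).

Definition bifun F (p : 'rV[R]_n * 'rV[R]_n) : R :=
  dotp (F p) (p.2 - p.1).

Definition gap F C (alpha : R) (x : 'rV[R]_n) : R :=
  setmax [set - bifun F (x, y) - alpha / 2 * enorm (y - x) ^+ 2 | y in C].

(* The library Jacobian is the matrix J with v *m J = 'd (F (., y)) x v, the
   transpose of the column-vector convention; this agrees with opnorm. *)
Definition nabla1 F (x y : 'rV[R]_n) : 'M[R]_n :=
  'J (fun z => F (z, y)) x.

Definition L1 F B C : R := setmax [set enorm (F p) | p in B `*` C].

Definition L2 B C : R := setmax [set enorm (p.1 - p.2) | p in B `*` C].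

Definition L3 F B C (alpha : R) : R :=
  setmax [set opnorm (alpha%:M - nabla1 F p.1 p.2) | p in B `*` C].

End gap.

(* Main.v *)
Require Import Defs.
From mathcomp Require Import all_boot all_order all_algebra.
From mathcomp Require Import all_classical all_reals all_analysis.
From mathcomp Require Import ring lra.
Import Order.TTheory GRing.Theory Num.Theory.
Import numFieldNormedType.Exports.

Local Open Scope classical_set_scope.
Local Open Scope ring_scope.

(** For fixed [y], the derivative in [z] along [v] of the maximized expression
    [<F (z, y), z - y> - alpha / 2 |z - y|^2] is
    [<F (z, y), v> - <v *m (alpha I - nabla1 F z y), z - y>], which Cauchy-Schwarz
    bounds by [(L1 + L2 L3) |v|] when [z] is in [B] and [y] in [C]. The mean value
    theorem along the segment from [x'] to [x], which stays in the convex set [B],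
    turns this into a Lipschitz bound uniform in [y], and a maximum over [y] inherits
    it. The suprema in [L1], [L2], [L3] and in the gap function are attained by
    compactness; for [L3] this rests on the continuity of the operator norm. *)

Set Implicit Arguments.
Unset Strict Implicit.
Unset Printing Implicit Defensive.

(** * Euclidean inner product, norm and operator norm *)

Section euclidean.
Variable R : realType.

Lemma dotpC n (u v : 'rV[R]_n) : dotp u v = dotp v u.
Proof. by apply: eq_bigr => i _; rewrite mulrC. Qed.

Lemma dotpDl n (u v w : 'rV[R]_n) : dotp (u + v) w = dotp u w + dotp v w.
Proof. by rewrite -big_split; apply: eq_bigr => i _; rewrite mxE mulrDl. Qed.

Lemma dotpZl n (a : R) (u v : 'rV[R]_n) : dotp (a *: u) v = a * dotp u v.
Proof. by rewrite mulr_sumr; apply: eq_bigr => i _; rewrite mxE mulrA. Qed.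

Lemma dotpNl n (u v : 'rV[R]_n) : dotp (- u) v = - dotp u v.
Proof. by rewrite -scaleN1r dotpZl mulN1r. Qed.

Lemma dotpNr n (u v : 'rV[R]_n) : dotp u (- v) = - dotp u v.
Proof. by rewrite dotpC dotpNl dotpC. Qed.

Lemma dotp_ge0 n (u : 'rV[R]_n) : 0 <= dotp u u.
Proof. by apply: sumr_ge0 => i _; rewrite -expr2 sqr_ge0. Qed.

Lemma enorm_ge0 n (u : 'rV[R]_n) : 0 <= enorm u.
Proof. exact: sqrtr_ge0. Qed.

Lemma sqr_enorm n (u : 'rV[R]_n) : enorm u ^+ 2 = dotp u u.
Proof. by rewrite sqr_sqrtr// dotp_ge0. Qed.

Lemma enorm0 n : enorm (0 : 'rV[R]_n) = 0.
Proof. by rewrite /enorm /dotp big1 ?sqrtr0// => i _; rewrite mxE mul0r. Qed.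

Lemma enorm0_eq0 n (u : 'rV[R]_n) : enorm u = 0 -> u = 0.
Proof.
move=> u0; have : dotp u u = 0 by rewrite -sqr_enorm u0 expr0n.
move=> /psumr_eq0P uu0; apply/rowP => i; rewrite mxE.
have /eqP := uu0 (fun i _ => ltac:(by rewrite -expr2 sqr_ge0)) i isT.
by rewrite mulf_eq0 orbb => /eqP.
Qed.

Lemma enormZ n (a : R) (u : 'rV[R]_n) : enorm (a *: u) = `|a| * enorm u.
Proof.
rewrite /enorm dotpZl dotpC dotpZl mulrA -expr2 sqrtrM ?sqr_ge0//.
by rewrite sqrtr_sqr.
Qed.

Lemma enormN n (u : 'rV[R]_n) : enorm (- u) = enorm u.
Proof. by rewrite -scaleN1r enormZ normrN1 mul1r. Qed.

(** For nonzero [u], the vector [<u,u> v - <u,v> u] has squared norm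
    [<u,u> (<u,u> <v,v> - <u,v>^2)]; this is nonnegative, and the factor [<u,u>] is positive. *)
Lemma Cauchy_Schwarz n (u v : 'rV[R]_n) : `|dotp u v| <= enorm u * enorm v.
Proof.
have [u0|u0] := eqVneq (enorm u) 0.
  rewrite u0 mul0r (enorm0_eq0 u0) /dotp big1 ?normr0// => i _.
  by rewrite mxE mul0r.
have uu_gt0 : 0 < dotp u u by rewrite -sqr_enorm exprn_gt0// lt0r u0 enorm_ge0.
rewrite -(@ler_pXn2r _ 2) ?nnegrE ?mulr_ge0 ?enorm_ge0//.
rewrite real_normK ?num_real// exprMn !sqr_enorm.
have := dotp_ge0 (dotp u u *: v + (- dotp u v) *: u).
rewrite dotpDl !dotpZl (dotpC v) (dotpC u (_ + _)) !dotpDl !dotpZl (dotpC v u).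
move=> h; have : 0 <= dotp u u * (dotp u u * dotp v v - dotp u v ^+ 2).
  by apply: le_trans h _; rewrite le_eqVlt; apply/orP; left; apply/eqP; ring.
by rewrite pmulr_rge0// subr_ge0.
Qed.

Lemma ler_enormD n (u v : 'rV[R]_n) : enorm (u + v) <= enorm u + enorm v.
Proof.
rewrite -(@ler_pXn2r _ 2) ?nnegrE ?addr_ge0 ?enorm_ge0//.
rewrite sqr_enorm dotpDl (dotpC u (_ + _)) (dotpC v (_ + _)) !dotpDl -!sqr_enorm.
have := le_trans (ler_norm _) (Cauchy_Schwarz u v); rewrite (dotpC v u); nra.
Qed.

Lemma ler_enorm_sum (I : Type) (s : seq I) (n : nat) (u : I -> 'rV[R]_n) :
  enorm (\sum_(i <- s) u i) <= \sum_(i <- s) enorm (u i).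
Proof.
elim: s => [|i s IHs]; first by rewrite !big_nil enorm0.
by rewrite !big_cons (le_trans (ler_enormD _ _))// lerD2l.
Qed.

Lemma ler_coord_enorm n (u : 'rV[R]_n) i : `|u 0 i| <= enorm u.
Proof.
rewrite -sqrtr_sqr ler_wsqrtr// /dotp (bigD1 i)//= expr2 lerDl.
by apply: sumr_ge0 => j _; rewrite -expr2 sqr_ge0.
Qed.

(** [v *m A] is the combination of the rows of [A] with the coordinates of [v] as coefficients. This
    crude bound makes the supremum in [opnorm] finite and later yields its continuity. *)
Lemma enorm_mulmx_le_rows m n (v : 'rV[R]_m) (A : 'M[R]_(m, n)) :
  enorm (v *m A) <= enorm v * \sum_(i < m) enorm (row i A).
Proof.
rewrite mulmx_sum_row (le_trans (ler_enorm_sum _ _))// mulr_sumr ler_sum//.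
by move=> i _; rewrite enormZ ler_wpM2r ?enorm_ge0 ?ler_coord_enorm.
Qed.

Lemma opnorm_has_sup m n (A : 'M[R]_(m, n)) :
  has_sup [set enorm (v *m A) | v in [set v : 'rV[R]_m | enorm v <= 1]].
Proof.
split; first by exists (enorm (0 *m A)); exists 0 => //=; rewrite enorm0.
exists (\sum_(i < m) enorm (row i A)) => _ [v /= v1 <-].
rewrite (le_trans (enorm_mulmx_le_rows _ _))// ler_piMl//.
by apply: sumr_ge0 => i _; exact: enorm_ge0.
Qed.

(** By homogeneity: a nonzero [v] is rescaled to norm 1, where the supremum applies. *)
Lemma enorm_mulmx_le m n (v : 'rV[R]_m) (A : 'M[R]_(m, n)) :
  enorm (v *m A) <= opnorm A * enorm v.
Proof.
have [v0|v0] := eqVneq (enorm v) 0.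
  by rewrite v0 (enorm0_eq0 v0) mul0mx enorm0 mulr0.
have v_gt0 : 0 < enorm v by rewrite lt0r v0 enorm_ge0.
rewrite -ler_pdivrMr// mulrC -[_^-1]gtr0_norm ?invr_gt0// -enormZ scalemxAl.
apply: sup_upper_bound; first exact: opnorm_has_sup.
by exists ((enorm v)^-1 *: v) => //=; rewrite enormZ gtr0_norm ?invr_gt0// mulVf.
Qed.

(** Write [A = B + (A - B)] on the unit ball. Used in both orders, this controls the variation of
    [opnorm] by an expression continuous in the entries. *)
Lemma opnorm_le_add m n (A B : 'M[R]_(m, n)) :
  opnorm A <= opnorm B + \sum_(i < m) enorm (row i (A - B)).
Proof.
apply: ge_sup => [|_ [v /= v1 <-]]; first exact: (opnorm_has_sup A).1.
rewrite -[in leLHS](subrK B A) addrC mulmxDr (le_trans (ler_enormD _ _))// lerD//.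
  rewrite (le_trans (enorm_mulmx_le _ _))// ler_piMr//.
  (* The remaining goal is [0 <= opnorm B], seen by evaluating at the zero vector. *)
  apply: le_trans (sup_upper_bound (opnorm_has_sup B) _).
    exact: (enorm_ge0 (0 *m B)).
  by exists 0 => //=; rewrite enorm0.
rewrite (le_trans (enorm_mulmx_le_rows _ _))// ler_piMl//.
by apply: sumr_ge0 => i _; exact: enorm_ge0.
Qed.

(** * Continuity of the norms and attained maxima *)

Section continuity.
Context {T : topologicalType}.

Lemma continuous_coord m n (f : T -> 'M[R]_(m, n)) i j :
  continuous f -> continuous (fun t => f t i j).
Proof.
move=> fc t.
apply: (@continuous_comp _ _ _ f (fun M : 'M[R]_(m, n) => M i j)); first exact: fc.
exact: coord_continuous.
Qed.

Lemma continuous_enorm n (u : T -> 'rV[R]_n) :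
  (forall i, continuous (fun t => u t 0 i)) -> continuous (fun t => enorm (u t)).
Proof.
move=> uc t; apply: (@continuous_comp _ _ _ (fun t => dotp (u t) (u t)) (@Num.sqrt R)).
  2: exact: sqrt_continuous.
apply: cvg_big => [|i _]; first exact: add_continuous.
by apply: cvgM; exact: uc.
Qed.

Lemma continuous_opnorm m n (A : T -> 'M[R]_(m, n)) :
  (forall i j, continuous (fun t => A t i j)) ->
  continuous (fun t => opnorm (A t)).
Proof.
move=> Ac t; apply/cvgrPdist_le => e e0.
(* This sum tends to 0 as [s] tends to [t], and it dominates the difference of the two operator
   norms in both directions. *)
have : (fun s => \sum_(i < m) enorm (row i (A t - A s))) @ t -->
       \sum_(i < m) enorm (row i (A t - A t)).
  apply: cvg_big => [|i _]; first exact: add_continuous.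
  apply: (@continuous_enorm n (fun s => row i (A t - A s))).
  move=> j s.
  rewrite (_ : (fun _ => _) = (fun s => A t i j - A s i j)); last first.
    by apply/funext => r; rewrite !mxE.
  by apply: cvgB; [exact: cvg_cst | exact: Ac].
rewrite big1 => [|i _]; last by rewrite subrr row0 enorm0.
move=> /cvgrPdist_le /(_ _ e0); apply: filterS => s.
rewrite sub0r normrN ger0_norm; last first.
  by apply: sumr_ge0 => i _; exact: enorm_ge0.
move=> se; have := opnorm_le_add (A t) (A s); have := opnorm_le_add (A s) (A t).
have -> : \sum_(i < m) enorm (row i (A s - A t)) =
          \sum_(i < m) enorm (row i (A t - A s)).
  by apply: eq_bigr => i _; rewrite -opprB linearN enormN.
by rewrite ler_distl; lra.
Qed.

(** The extreme value theorem provides a greatest element, so [setmax] does not fall back on its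
    default value 0. *)
Lemma setmax_continuous_compact (K : set T) (f : T -> R) :
  K !=set0 -> compact K -> continuous f ->
  (exists2 c, K c & setmax [set f t | t in K] = f c) /\
  (forall t, K t -> f t <= setmax [set f t | t in K]).
Proof.
move=> K0 Kc fc.
have [c cK cmax] := compact_EVT_max K0 Kc (continuous_subspaceT fc).
have [] : ([set f t | t in K] `&` ubound [set f t | t in K])
          (setmax [set f t | t in K]).
  apply: (@xgetPex _ 0); exists (f c); split; first by exists c => //; exact: set_mem.
  by move=> _ [t Kt <-]; apply: cmax; exact: mem_set.
move=> [d Kd <-] dmax; split; first by exists d.
by move=> t Kt; apply: dmax; exists t.
Qed.

(** At a maximizer [c] of [f], [f c <= g c + e], which is at most the maximum of [g] plus [e]; the
    other direction uses a maximizer of [g]. *)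
Lemma setmax_lipschitz (K : set T) (f g : T -> R) (e : R) :
  K !=set0 -> compact K -> continuous f -> continuous g ->
  (forall t, K t -> `|f t - g t| <= e) ->
  `|setmax [set f t | t in K] - setmax [set g t | t in K]| <= e.
Proof.
move=> K0 Kc fc gc fge.
have [[c Kc' fE] fmax] := setmax_continuous_compact K0 Kc fc.
have [[d Kd gE] gmax] := setmax_continuous_compact K0 Kc gc.
have := gmax _ Kc'; have := fmax _ Kd; have := fge _ Kd; have := fge _ Kc'.
by rewrite fE gE !ler_distl; lra.
Qed.

End continuity.

(** * Directional derivatives and the mean value inequality *)

Section derivation.
Context {V : normedModType R}.

Lemma is_derive_dotp n (f g : V -> 'rV[R]_n) (x v : V) (df dg : 'rV[R]_n) :
  is_derive x v f df -> is_derive x v g dg ->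
  is_derive x v (fun z => dotp (f z) (g z)) (dotp df (g x) + dotp (f x) dg).
Proof.
move=> [fx <-] [gx <-].
have fi i : is_derive x v (fun z => f z 0 i) (('D_v f x) 0 i).
  rewrite (derive_mx fx) mxE; apply: derivableP.
  by move: fx => /derivable_mxP; apply.
have gi i : is_derive x v (fun z => g z 0 i) (('D_v g x) 0 i).
  rewrite (derive_mx gx) mxE; apply: derivableP.
  by move: gx => /derivable_mxP; apply.
rewrite (_ : (fun _ => _) =
    \sum_(i < n) ((fun z => f z 0 i) * (fun z => g z 0 i))); last first.
  by apply/funext => z; rewrite fct_sumE.
apply: (is_derive_eq (is_derive_sum (fun i => is_deriveM (fi i) (gi i)))).
rewrite /dotp -big_split; apply: eq_bigr => i _ /=.
by rewrite addrC; congr (_ + _); exact: mulrC.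
Qed.

(** The difference quotient of [f] at [x + t *: v] along [v] and that of the restriction to the line
    at [t] are the same function of [h]. *)
Lemma is_derive_line (f : V -> R) (x v : V) (t df : R) :
  is_derive (x + t *: v) v f df -> is_derive t 1 (fun s : R => f (x + s *: v)) df.
Proof.
have E : (fun h : R => h^-1 *: (f (h *: v + (x + t *: v)) - f (x + t *: v))) =
         (fun h : R => h^-1 *: (f (x + (h *: 1 + t) *: v) - f (x + t *: v))).
  by apply/funext => h; rewrite [h *: 1]mulr1 scalerDl addrCA.
by move=> [fx <-]; split; rewrite /derivable /derive /=; rewrite -E.
Qed.

(** The mean value theorem on [[0, 1]] is applied to [s |-> f (x' + s *: (x - x'))]. The bound is
    needed only in [B] and along [x - x']. *)
Lemma segment_mean_value (B : set V) (f : V -> R) (df : V -> V -> R) (K : R)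
    (x x' : V) :
  convex_set B -> B x -> B x' ->
  (forall z v, is_derive z v f (df z v)) ->
  (forall z, B z -> `|df z (x - x')| <= K) ->
  `|f x - f x'| <= K.
Proof.
move=> Bconv Bx Bx' fdf dfK.
have D (t : R) : is_derive t 1 (fun s : R => f (x' + s *: (x - x')))
    (df (x' + t *: (x - x')) (x - x')).
  by apply: is_derive_line; exact: fdf.
have [c c01] : exists2 c, c \in `]0, 1[%R &
    f (x' + 1 *: (x - x')) - f (x' + 0 *: (x - x')) =
    df (x' + c *: (x - x')) (x - x') * (1 - 0).
  apply: (@MVT R (fun s => f (x' + s *: (x - x')))
    (fun s => df (x' + s *: (x - x')) (x - x'))) => //.
  apply: derivable_within_continuous => t _.
  exact: ex_derive.
rewrite scale1r scale0r addr0 (addrC x') subrK subr0 mulr1 => ->.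
apply: dfK; move: c01; rewrite in_itv/= => /andP[c0 c1].
(* The intermediate point is the convex combination [c x + (1 - c) x']. *)
have := Bconv x x' (Itv01 (ltW c0) (ltW c1)) (mem_set Bx) (mem_set Bx').
move=> /set_mem; congr (B _).
by rewrite /conv/= scalerBr scalerBl scale1r addrCA addrA addrC addrA.
Qed.

End derivation.

(** Chain rule through [z |-> (z, y)], whose differential is [u |-> (u, 0)]. Continuity of the joint
    derivative thus passes to [nabla1]. *)
Lemma nabla1E n (F : 'rV[R]_n * 'rV[R]_n -> 'rV[R]_n) (x y : 'rV[R]_n) i j :
  differentiable F (x, y) ->
  nabla1 F x y i j =
  lin1_mx (fun u : 'rV[R]_(n + n) => 'd F (x, y) (lsubmx u, rsubmx u))
    (lshift n i) j.
Proof.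
move=> dF; rewrite /nabla1 /jacobian !mxE.
have [dg gE] : is_diff x (fun z : 'rV[R]_n => (id z, cst y z)) (fun u => (id u, 0)).
  exact: (is_diff_pair (is_diff_id x) (is_diff_cst y x)).
rewrite (_ : (fun z => F (z, y)) = F \o (fun z => (id z, cst y z)))//.
rewrite (diff_comp dg dF)/= gE/=.
congr (('d F (x, y) (_, _) : 'rV_n) 0 j).
  (* The basis vector of index [lshift n i] splits into the [i]-th basis vector and 0. *)
  by apply/rowP => k; rewrite !mxE/= (inj_eq (@lshift_inj _ _)).
by apply/rowP => k; rewrite !mxE/= eq_rlshift.
Qed.

(** Product rule, with [y - z] having derivative [- v]: the quadratic term contributes
    [- <alpha v, z - y>], which merges with the Jacobian term [<v *m nabla1 F z y, z - y>]. *)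
Lemma is_derive_gap_integrand n (F : 'rV[R]_n * 'rV[R]_n -> 'rV[R]_n)
    (alpha : R) (y z v : 'rV[R]_n) :
  differentiable F (z, y) ->
  is_derive z v (fun z => - bifun F (z, y) - alpha / 2 * enorm (y - z) ^+ 2)
    (dotp (F (z, y)) v - dotp (v *m (alpha%:M - nabla1 F z y)) (z - y)).
Proof.
move=> dF; have dFy : differentiable (fun z => F (z, y)) z.
  apply: (differentiable_comp (f := fun z => (id z, cst y z)) (g := F)) dF.
  exact: differentiable_pair.
have D1 : is_derive z v (fun z => F (z, y)) (v *m nabla1 F z y).
  by rewrite -deriveEjacobian//; apply: derivableP; exact: diff_derivable.
have D2 : is_derive z v (fun z => y - z) (- v).
  by apply: is_derive_eq; rewrite sub0r.
have D3 := is_derive_dotp D1 D2.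
have D4 := is_derive_dotp D2 D2.
rewrite (_ : (fun _ => _) = - (fun z => dotp (F (z, y)) (y - z)) -
  (alpha / 2) *: (fun z => dotp (y - z) (y - z))); last first.
  by apply/funext => w; rewrite sqr_enorm.
apply: is_derive_eq; rewrite mulmxBr mul_mx_scalar (dotpDl (alpha *: v)).
rewrite !dotpNl dotpZl -[z - y]opprB !dotpNr (dotpC (y - z) v) /GRing.scale/=.
by field.
Qed.

End euclidean.

(** * The Lipschitz estimate for the gap function *)

Unset Implicit Arguments.

Theorem theorem3p2 (R : realType) (n : nat)
  (C : set 'rV[R]_n) (F : 'rV[R]_n * 'rV[R]_n -> 'rV[R]_n)
  (C_nonempty : C !=set0) (C_compact : compact C) (C_convex : convex_set C)
  (f_continuous : continuous (bifun F))
  (f_convex : forall x, C x ->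
    convex_function setT (fun y : 'rV[R]_n => bifun F (x, y)))
  (f_diag : forall x, C x -> bifun F (x, x) = 0)
  (B : set 'rV[R]_n)
  (B_nonempty : B !=set0) (B_convex : convex_set B) (B_compact : compact B)
  (F_C1 : continuously_differentiable F)
  (alpha : R) (alpha_gt0 : 0 < alpha) :
  forall x x' : 'rV[R]_n, B x -> B x' ->
    `|gap F C alpha x - gap F C alpha x'|
      <= (L1 F B C + L2 B C * L3 F B C alpha) * enorm (x - x').
Proof.
move=> x x' Bx Bx'; have [dF JF] := F_C1.
have BC0 : B `*` C !=set0.
  by have [b Bb] := B_nonempty; have [c Cc] := C_nonempty; exists (b, c).
have BCc : compact (B `*` C) by exact: compact_setX.
have L1_ub p : (B `*` C) p -> enorm (F p) <= L1 F B C.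
  suff fc : continuous (fun p => enorm (F p)).
    exact: (setmax_continuous_compact BC0 BCc fc).2.
  apply: continuous_enorm => i; apply: continuous_coord => q.
  exact: differentiable_continuous.
have L2_ub p : (B `*` C) p -> enorm (p.1 - p.2) <= L2 B C.
  suff fc : continuous (fun p : 'rV[R]_n * 'rV[R]_n => enorm (p.1 - p.2)).
    exact: (setmax_continuous_compact BC0 BCc fc).2.
  apply: continuous_enorm => i; apply: continuous_coord => q.
  by apply: cvgB; [exact: cvg_fst | exact: cvg_snd].
have L3_ub p : (B `*` C) p ->
    opnorm (alpha%:M - nabla1 F p.1 p.2) <= L3 F B C alpha.
  suff fc : continuous (fun p : 'rV[R]_n * 'rV[R]_n =>
      opnorm (alpha%:M - nabla1 F p.1 p.2)).
    exact: (setmax_continuous_compact BC0 BCc fc).2.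
  apply: continuous_opnorm => i j.
  (* Each entry of [nabla1 F] is an entry of the joint derivative matrix, continuous by [JF]. *)
  rewrite (_ : (fun _ => _) = (fun p => (alpha%:M : 'M[R]_n) i j -
    lin1_mx (fun u : 'rV[R]_(n + n) => 'd F p (lsubmx u, rsubmx u))
      (lshift n i) j)); last first.
    apply/funext => -[z y]; rewrite -(nabla1E i j (dF (z, y))) mxE.
    by congr (_ + _); rewrite [LHS]mxE.
  move=> q; apply: cvgB; first exact: cvg_cst.
  exact: (continuous_coord JF).
(* Continuity in [y] makes the maxima defining the gap function at [x] and [x'] attained. *)
have gapc z : continuous (fun y => - bifun F (z, y) - alpha / 2 * enorm (y - z) ^+ 2).
  have bc : continuous (fun y => bifun F (z, y)).
    move=> y; apply: (@continuous_comp _ _ _ (fun y : 'rV[R]_n => (z, y)) (bifun F)).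
      apply: (@cvg_pair _ _ _ (nbhs y) (nbhs z) (nbhs y) _ _ _ (fun=> z) id).
        exact: cvg_cst.
      exact: cvg_id.
    exact: f_continuous.
  have ec : continuous (fun y : 'rV[R]_n => enorm (y - z)).
    apply: continuous_enorm => i; apply: continuous_coord => w.
    exact: (continuousB (@cvg_id _ _) (@cvg_cst _ _ _ _ _)).
  move=> y; apply: (continuousB (continuousN (bc y))).
  have kc : {for y, continuous (cst (alpha / 2))} by exact: cst_continuous.
  exact: (continuousM kc (continuousM (ec y) (ec y))).
apply: setmax_lipschitz => // y Cy.
apply: (@segment_mean_value R _ B
  (fun z => - bifun F (z, y) - alpha / 2 * enorm (y - z) ^+ 2) _ _ _ _ B_convex) => //.
  by move=> z v; apply: is_derive_gap_integrand; exact: dF.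
move=> z Bz.
have BCzy : (B `*` C) (z, y) by [].
(* The term [<F (z, y), v>], with [v = x - x'], gives [L1]. In the other term [z - y] gives [L2],
   and the matrix product gives [L3] times the norm of [v]. *)
rewrite mulrDl (le_trans (ler_normB _ _))// lerD//.
  rewrite (le_trans (Cauchy_Schwarz _ _))// ler_wpM2r ?enorm_ge0//.
  exact: (L1_ub (z, y)).
rewrite (le_trans (Cauchy_Schwarz _ _))// mulrC -mulrA.
rewrite ler_pM ?enorm_ge0//; first exact: (L2_ub (z, y)).
rewrite (le_trans (enorm_mulmx_le _ _))// ler_wpM2r ?enorm_ge0//.
exact: (L3_ub (z, y)).
Qed.
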